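(* Let $\varphi\in\mathbf N[\alpha,\beta]$ and let $z\in\mathbb C_+$ be a fixed number. Then there exist numbers $a^{(1)},a^{(2)}\in\mathbb R$ and $b>0$ such that the function $\tau$ defined by the equality $$\varphi(\lambda)=-\frac{1}{a^{(2)}\lambda-a^{(1)}+b^2(\lambda-z)(\lambda-\overline z)\tau(\lambda)}$$ belongs to $\mathbf N^0[\alpha,\beta]:=\mathbf N[\alpha,\beta]\cup\{0\}$.
   Context: $\mathbb C_+$ is the open upper half plane and $\alpha<\beta$ are real numbers. $\mathbf N[\alpha,\beta]$ denotes the class of all functions $\varphi$ (Markov functions) having the representation $$\varphi(\lambda)=\int_\alpha^\beta\frac{d\sigma(t)}{t-\lambda},\qquad \lambda\in\mathbb C\setminus[\alpha,\beta],$$ where $\sigma$ is a finite nonzero positive Borel measure on $[\alpha,\beta]$; $\mathbf N^0[\alpha,\beta]$ is this class with the zero function adjoined. *)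

(* Defs.v *)
From HB Require Import structures.
From mathcomp Require Import all_boot all_order all_algebra.
From mathcomp Require Import complex.
From mathcomp Require Import all_classical all_reals all_analysis.
Set Implicit Arguments.
Unset Strict Implicit.
Unset Printing Implicit Defensive.
Import Order.TTheory GRing.Theory Num.Theory.
Local Open Scope classical_set_scope.
Local Open Scope ring_scope.
Local Open Scope complex_scope.

Section MarkovFunctions.
Context {R : realType}.

Definition cintegral d (T : measurableType d) (mu : {measure set T -> \bar R})
    (D : set T) (f : T -> R[i]) : R[i] :=
  (\int[mu]_(t in D) complex.Re (f t)) +i* (\int[mu]_(t in D) complex.Im (f t)).

Definition real_segment (alpha beta : R) : set R[i] :=
  [set t%:C | t in `[alpha, beta]%classic].

(* A finite nonzero Borel measure on [alpha, beta] is given as a measure on the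
   line whose complement of [alpha, beta] is null.  Functions defined on
   C \ [alpha, beta] are total functions whose values on the segment are
   irrelevant: the classes below do not constrain them. *)
Definition markov_class (alpha beta : R) : set (R[i] -> R[i]) :=
  [set phi | exists sigma : {finite_measure set (measurableTypeR R) -> \bar R},
    [/\ sigma (~` `[alpha, beta]%classic) = 0%E,
        sigma `[alpha, beta]%classic <> 0%E &
        forall lambda, (~` real_segment alpha beta) lambda ->
          phi lambda =
            cintegral sigma `[alpha, beta]%classic (fun t => (t%:C - lambda)^-1)]].

Definition markov_class0 (alpha beta : R) : set (R[i] -> R[i]) :=
  markov_class alpha beta `|`
  [set phi | forall lambda, (~` real_segment alpha beta) lambda -> phi lambda = 0].

End MarkovFunctions.

(* Main.v *)
Require Import Defs.
From HB Require Import structures.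
From mathcomp Require Import all_boot all_order all_algebra.
From mathcomp Require Import ring lra.
From mathcomp Require Import complex.
From mathcomp Require Import all_classical all_reals all_analysis.
From mathcomp Require Import measurable_realfun.
Import Order.TTheory GRing.Theory Num.Theory.
Import numFieldNormedType.Exports.
Local Open Scope classical_set_scope.
Local Open Scope ring_scope.
Local Open Scope complex_scope.

(** The negative reciprocal of a Markov function is again, up to an affine term,
    a Markov function: - 1 / phi = a x + b + rho^ with rho^ the Markov function
    of a measure rho.  Subtracting from it the real affine function
    a2 x - a1 which agrees with it at z (hence at conj z), and dividing by
    (x - z)(x - conj z), replaces 1 / (t - x) by
    1 / (|t - z|^2 (t - x)).  So tau is the Markov function of the measure
    |t - z|^(-2) d rho, and one can take b = 1.

    This is proved for discrete measures first, where it is algebra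
    ([discrete_inverse]).  If phi is the sum of w_j / (t_j - x) with
    w_j > 0, it has a zero s_k between any two consecutive t_k
    ([interlacing_zero]), and tau is an explicit sum of simple fractions with
    poles s_k; the identity holds because a polynomial of low degree vanishes
    at all the s_k, at z and at conj z ([inverse_partial_fractions]).

    The general case follows by compactness.  The measure sigma of phi is
    approximated by discrete measures on finer and finer grids, with Markov
    functions phi_n tending to phi off the segment ([grid_weight_cvg]).  The
    coefficients a1, a2 are determined by the value at z, so they converge.
    Then tau_n converges at a point of the upper half plane above z, where the
    imaginary part of tau_n bounds the total mass of its measure
    ([stieltjes_sum_mass_bounded]).  Bounded masses on a segment allow passing
    to a limit measure mu along an ultrafilter ([helly]), and tau is the Markov
    function of mu, or zero when mu is zero.  Off the segment the kernel
    1 / (t - x) is Lipschitz in t on the segment ([resolvent_lipschitz]), so all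
    convergence statements are needed for Lipschitz functions only, for which
    Riemann-Stieltjes sums give uniform error bounds ([rsum_heaviside_err]). *)

(** * Discrete measures *)

Lemma size_XsubC_mul {F : fieldType} (x : F) (p : {poly F}) :
  p != 0 -> size (('X - x%:P) * p) = (size p).+1.
Proof. by move=> p0; rewrite size_monicM ?monicXsubC// size_XsubC. Qed.

(** Partial fractions of the negative reciprocal of phi = sum of w_j / (t_j - x).
    With P = prod (X - t_j) one has phi = - Q / P, and the zeros s_k of phi are
    the roots of Q.  After multiplication by P the conclusion reads S = 0 for
    a polynomial S of size at most n + 2; S vanishes at the n zeros s_k, by the
    choice of the masses m k, and at z and z', by the choice of the affine part
    a2 * x - a1.  That is n + 2 roots, so S = 0. *)
Section InversePartialFractions.
Context {F : fieldType} (n : nat).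
Variables (t w : 'I_n.+1 -> F) (s : 'I_n -> F) (z z' a1 a2 : F).
Hypothesis ts : forall j k, t j != s k.
Hypothesis s_inj : injective s.
Hypothesis zz' : z != z'.
Hypothesis zs : forall k, z != s k.
Hypothesis z's : forall k, z' != s k.
Hypothesis zt : forall j, z != t j.
Hypothesis z't : forall j, z' != t j.
Let phi x := \sum_j w j / (t j - x).
Let slope k := \sum_j w j / (t j - s k) ^+ 2.
Hypothesis s_zero : forall k, phi (s k) = 0.
Hypothesis slope_neq0 : forall k, slope k != 0.
Hypothesis interp_z : 1 + phi z * (a2 * z - a1) = 0.
Hypothesis interp_z' : 1 + phi z' * (a2 * z' - a1) = 0.
Let m k := ((s k - z) * (s k - z') * slope k)^-1.

Let P : {poly F} := \prod_j ('X - (t j)%:P).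
Let Pd j : {poly F} := \prod_(i | i != j) ('X - (t i)%:P).
Let Q : {poly F} := \sum_j w j *: Pd j.
(* The cofactor of X - s_k in Q, in a form that shows its value at s_k. *)
Let Qd k : {poly F} := \sum_j (w j / (t j - s k)) *: Pd j.

Let PE j : P = ('X - (t j)%:P) * Pd j.
Proof. by rewrite /P (bigD1 j). Qed.

Let sizeP : size P = n.+2.
Proof. by rewrite /P -big_enum size_prod_XsubC size_enum_ord. Qed.

Let sizePd j : size (Pd j) = n.+1.
Proof.
have := sizeP; rewrite (PE j) size_XsubC_mul; first by case.
apply/eqP => P0; have := sizeP; by rewrite (PE j) P0 mulr0 size_poly0.
Qed.

Let sizeQ : (size Q <= n.+1)%N.
Proof.
apply: (leq_trans (size_sum _ _ _)); apply/bigmax_leqP => j _.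
by apply: (leq_trans (size_scale_leq _ _)); rewrite sizePd.
Qed.

Let P_eq0 x : (P.[x] == 0) = [exists j, x == t j].
Proof.
rewrite /P horner_prod; apply/eqP/existsP => [/eqP/prodf_eq0[j _]|[j /eqP->]].
  by rewrite hornerXsubC subr_eq0 => xj; exists j.
by rewrite (bigD1 j)//= hornerXsubC subrr mul0r.
Qed.

Let P_neq0 x : (forall j, x != t j) -> P.[x] != 0.
Proof. by move=> xt; rewrite P_eq0; apply/existsP => -[j]; apply/negP. Qed.

Let PdE j x : x != t j -> (Pd j).[x] = - P.[x] / (t j - x).
Proof.
move=> xt; rewrite (PE j) hornerM hornerXsubC -mulNr opprB mulrAC divff ?mul1r//.
by rewrite subr_eq0 eq_sym.
Qed.

Let QE x : (forall j, x != t j) -> Q.[x] = - P.[x] * phi x.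
Proof.
move=> xt; rewrite horner_sum mulr_sumr; apply: eq_bigr => j _.
by rewrite hornerZ PdE// mulrCA mulrA.
Qed.

Let QdE k : Q = ('X - (s k)%:P) * Qd k.
Proof.
(* (X - s_k) Pd_j = P + (t_j - s_k) Pd_j, and the terms in P sum to phi (s_k) P,
   which is zero. *)
transitivity (Q + phi (s k) *: P); first by rewrite s_zero scale0r addr0.
rewrite /Q /Qd mulr_sumr /phi scaler_suml -big_split/=; apply: eq_bigr => j _.
rewrite (PE j) -scalerAr.
have ->: ('X - (s k)%:P) = ('X - (t j)%:P) + (t j - s k)%:P :> {poly F}.
  by rewrite polyCB; ring.
rewrite [in RHS]mulrDl [RHS]scalerDr [LHS]addrC; congr (_ + _).
by rewrite mul_polyC scalerA divfK// subr_eq0.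
Qed.

Let sizeQd k : (size (Qd k) <= n)%N.
Proof.
have [->|Q0] := eqVneq (Qd k) 0; first by rewrite size_poly0.
by have := sizeQ; rewrite (QdE k) size_XsubC_mul.
Qed.

Let Qd_root k : (Qd k).[s k] = - P.[s k] * slope k.
Proof.
rewrite horner_sum mulr_sumr; apply: eq_bigr => j _.
rewrite hornerZ PdE 1?eq_sym// mulrCA; congr (_ * _).
by rewrite -mulrA expr2 -invfM.
Qed.

Let S : {poly F} := P - Q * (a2 *: 'X - a1%:P)
  + ('X - z%:P) * ('X - z'%:P) * \sum_k m k *: Qd k.

Let sizeS : (size S <= n.+2)%N.
Proof.
have size_lin : (size (a2 *: 'X - a1%:P)%R <= 2)%N.
  apply: (leq_trans (size_polyD _ _)); rewrite geq_max size_polyN.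
  rewrite (leq_trans (size_polyC_leq1 _))// andbT.
  by apply: (leq_trans (size_scale_leq _ _)); rewrite size_polyX.
apply: (leq_trans (size_polyD _ _)); rewrite geq_max; apply/andP; split.
  apply: (leq_trans (size_polyD _ _)); rewrite geq_max sizeP leqnn/= size_polyN.
  apply: (leq_trans (size_polyMleq _ _)).
  by have := leq_add sizeQ size_lin; case: (_ + _)%N => //= i; rewrite addn2.
apply: (leq_trans (size_polyMleq _ _)).
have -> : size (('X - z%:P) * ('X - z'%:P)) = 3.
  by rewrite size_XsubC_mul ?polyXsubC_eq0// size_XsubC.
rewrite addSn add2n/= ltnS ltnS.
apply: (leq_trans (size_sum _ _ _)); apply/bigmax_leqP => k _.
exact: (leq_trans (size_scale_leq _ _)).
Qed.

Let SE x : S.[x] = P.[x] - Q.[x] * (a2 * x - a1)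
  + (x - z) * (x - z') * \sum_k m k * (Qd k).[x].
Proof.
rewrite /S !(hornerE, horner_sum); congr (_ + _ * _).
by apply: eq_bigr => k _; rewrite hornerZ.
Qed.

Let S_interp x : (forall j, x != t j) -> (x - z) * (x - z') = 0 ->
  1 + phi x * (a2 * x - a1) = 0 -> S.[x] = 0.
Proof.
move=> xt x0 ix; rewrite SE x0 mul0r addr0 QE// !mulNr opprK.
by rewrite -mulrA -[X in X + _]mulr1 -mulrDr ix mulr0.
Qed.

Let S_s k : S.[s k] = 0.
Proof.
have Q0 : Q.[s k] = 0 by rewrite (QdE k) hornerM hornerXsubC subrr mul0r.
rewrite SE Q0 mul0r subr0 (bigD1 k)//= big1 ?addr0; last first.
  move=> i ik; have := Q0; rewrite (QdE i) hornerM hornerXsubC => /eqP.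
  rewrite mulf_eq0 subr_eq0 (inj_eq s_inj) eq_sym (negPf ik)/= => /eqP->.
  by rewrite mulr0.
rewrite Qd_root /m.
have sz : s k - z != 0 by rewrite subr_eq0 eq_sym.
have sz' : s k - z' != 0 by rewrite subr_eq0 eq_sym.
by field; rewrite slope_neq0 sz sz'.
Qed.

Let S0 : S = 0.
Proof.
pose rs := z :: z' :: [seq s k | k <- enum 'I_n].
apply: (@roots_geq_poly_eq0 _ _ rs).
- rewrite /rs /= /root S_interp ?subrr ?mul0r// S_interp ?subrr ?mulr0//= eqxx/=.
  by apply/allP => _ /mapP[k _ ->]; rewrite /root S_s.
- rewrite /rs/= inE negb_or zz'/= map_inj_uniq// enum_uniq andbT.
  by apply/andP; split; apply/mapP => -[k _ e]; [have := zs k|have := z's k];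
     rewrite e eqxx.
- by rewrite /rs/= size_map -cardE card_ord; exact: sizeS.
Qed.

Lemma inverse_partial_fractions x :
  (forall j, x != t j) -> (forall k, x != s k) ->
  1 + phi x * (a2 * x - a1
    + (x - z) * (x - z') * \sum_k m k / (s k - x)) = 0.
Proof.
move=> xt xs; have := SE x; rewrite S0 horner0 QE//.
have -> : \sum_k m k * (Qd k).[x] = P.[x] * phi x * \sum_k m k / (s k - x).
  rewrite mulr_sumr; apply: eq_bigr => k _; rewrite mulrCA; congr (_ * _).
  have := QE x xt; rewrite (QdE k) hornerM hornerXsubC => /(congr1 (-%R)).
  rewrite -mulNr opprB mulNr opprK => <-.
  by rewrite mulrAC divff ?mul1r// subr_eq0 eq_sym.
move=> e; apply: (mulfI (P_neq0 x xt)); rewrite mulr0 [RHS]e; ring.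
Qed.

End InversePartialFractions.

(** The numerator Q takes the value w_k * prod_(i != k) (t_k - t_i) at t_k, and
    these values have opposite signs at neighbouring poles: the two products
    agree in sign factor by factor, except for the factors t_k - t_(k+1) and
    t_(k+1) - t_k. *)
Lemma interlacing_zero (R : rcfType) (n : nat) (t w : nat -> R)
    (t_incr : {homo t : i j / (i < j)%N >-> i < j}) (w_gt0 : forall j, 0 < w j)
    (k : 'I_n) :
  exists2 s, t k < s < t k.+1 & \sum_(j < n.+1) w j / (t j - s) = 0.
Proof.
pose Pd (j : nat) : {poly R} := \prod_(i < n.+1 | i != j :> nat) ('X - (t i)%:P).
pose Q : {poly R} := \sum_(j < n.+1) w j *: Pd j.
have QE (j : 'I_n.+1) : Q.[t j] = w j * (Pd j).[t j].
  rewrite horner_sum (bigD1 j)//= big1 ?addr0 ?hornerZ// => i ij.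
  rewrite hornerZ horner_prod (bigD1 j)/= 1?eq_sym//.
  by rewrite hornerXsubC subrr mul0r mulr0.
have t_neq i j : i != j -> t i - t j != 0.
  by rewrite subr_eq0 => ij; apply/eqP => e; move: ij; case: ltngtP => // /t_incr;
    rewrite e ltxx.
pose k0 : 'I_n.+1 := widen_ord (leqnSn n) k; pose k1 : 'I_n.+1 := lift ord0 k.
have k1E : nat_of_ord k1 = k.+1 by [].
have QQ : Q.[t k] * Q.[t k.+1] < 0.
  rewrite (QE k0) -k1E (QE k1) mulrACA pmulr_rlt0 ?mulr_gt0//.
  rewrite !horner_prod (bigD1 k1)/=; last by rewrite eqn_leq ltnn.
  rewrite [X in _ * X](bigD1 k0)/=; last by rewrite eqn_leq ltnn andbF.
  rewrite !hornerXsubC mulrACA.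
  set A := \prod_(_ < _ | _) _; set B := \prod_(_ < _ | _) _.
  suff AB : 0 < A * B.
    rewrite pmulr_llt0// -[X in X * _]opprB mulNr oppr_lt0 -expr2.
    by rewrite exprn_even_gt0//= t_neq// eqn_leq ltnn.
  rewrite /A /B.
  under [X in _ * X]eq_bigl do rewrite andbC.
  rewrite -big_split/=; apply: prodr_gt0 => i /andP[ik ik1].
  have := ik; have := ik1.
  rewrite !hornerXsubC/= -!(inj_eq val_inj)/= /bump/= add1n => ik1' ik'.
  case: (ltngtP i k) ik' => // ik' _.
    by rewrite mulr_gt0// subr_gt0 t_incr// ltnW.
  have {}ik' : (k.+1 < i)%N by rewrite ltn_neqAle eq_sym ik1'.
  by rewrite nmulr_rgt0 subr_lt0 t_incr// ltnW.
have tk : t k <= t k.+1 by rewrite ltW// t_incr.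
have [s /andP[ks sk] Qs] : exists2 s, t k <= s <= t k.+1 & root Q s.
  have [Q0|Q0] := leP Q.[t k] 0.
    apply: poly_ivt => //; rewrite Q0/= leNgt; apply/negP => Q1.
    by move: QQ; rewrite ltNge mulr_le0// ltW.
  have [|s sI Qs] := @poly_ivt _ (- Q) (t k) (t k.+1) tk.
    rewrite !hornerN !oppr_le0 oppr_ge0 (ltW Q0)/=.
    by move: QQ; rewrite pmulr_rlt0// => /ltW.
  by exists s => //; rewrite -rootN.
have s_neq k' : Q.[t k'] != 0 -> s != t k'.
  by apply: contra_neq => <-; exact/eqP.
have {ks} ks : t k < s.
  rewrite lt_neqAle ks andbT eq_sym s_neq//.
  by apply: contraTneq QQ => ->; rewrite mul0r ltxx.
have {sk} sk : s < t k.+1.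
  rewrite lt_neqAle sk andbT s_neq//.
  by apply: contraTneq QQ => ->; rewrite mulr0 ltxx.
exists s; first by rewrite ks sk.
have st (j : nat) : s != t j.
  case: (leqP j k) => jk; rewrite neq_lt; apply/orP; [right|left].
    by apply: le_lt_trans ks; exact: ltW_homo.
  by apply: lt_le_trans sk _; exact: ltW_homo.
pose P : R := \prod_(j < n.+1) (s - t j).
have P0 : P != 0 by apply/prodf_neq0 => j _; rewrite subr_eq0.
apply: (mulfI P0); rewrite mulr0; apply/eqP; rewrite -oppr_eq0 -mulrN -sumrN.
rewrite mulr_sumr; apply/eqP; rewrite -[RHS](eqP Qs) horner_sum.
apply: eq_bigr => j _; rewrite hornerZ horner_prod /P (bigD1 j)//=.
under [X in _ = _ * X]eq_bigr do rewrite hornerXsubC.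
have := st j; rewrite -subr_eq0; set b := \prod_(_ < _ | _) _ => sj.
have -> : t j - s = - (s - t j) by rewrite opprB.
by field.
Qed.

(** The Markov function of the discrete measure with mass [m k] at [s k]. *)
Definition stieltjes_sum {R : realType} {n : nat} (m s : 'I_n -> R) (x : R[i]) : R[i] :=
  \sum_k (m k)%:C * ((s k)%:C - x)^-1.

Lemma stieltjes_sum_conj (R : realType) (n : nat) (m s : 'I_n -> R) (x : R[i]) :
  stieltjes_sum m s (conjc x) = conjc (stieltjes_sum m s x).
Proof.
rewrite rmorph_sum; apply: eq_bigr => k _.
by rewrite rmorphM fmorphV rmorphB; congr (_ / (_ - _)); rewrite /= oppr0.
Qed.

Lemma neq_real (R : realType) (x : R[i]) (r : R) : complex.Im x != 0 -> x != r%:C.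
Proof. by apply: contra_neq => ->. Qed.

(** The theorem for discrete measures: the representing measure of tau has a mass
    1 / (|s_k - z|^2 * phi'(s_k)) at each zero s_k of phi, which is positive
    because phi is increasing between consecutive poles. *)
Lemma discrete_inverse (R : realType) (n : nat) (t w : nat -> R) (z : R[i])
    (a1 a2 : R) (t_incr : {homo t : i j / (i < j)%N >-> i < j})
    (w_gt0 : forall j, 0 < w j) (hz : 0 < complex.Im z) :
  let phi := stieltjes_sum (fun j : 'I_n.+1 => w j) (fun j => t j) in
  1 + phi z * (a2%:C * z - a1%:C) = 0 ->
  exists m s : 'I_n -> R,
    (forall k, 0 <= m k /\ s k \in `[t 0%N, t n]) /\
    forall x, (~` real_segment (t 0%N) (t n)) x ->
      1 + phi x * (a2%:C * x - a1%:C
        + (x - z) * (x - conjc z) * stieltjes_sum m s x) = 0.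
Proof.
move=> phi iz.
have /= t_mono := ltW_homo t_incr.
pose s (k : 'I_n) := sval (cid2 (interlacing_zero R n t w t_incr w_gt0 k)).
have sI (k : 'I_n) : t k < s k < t k.+1.
  by rewrite /s; case: cid2.
have s0 (k : 'I_n) : \sum_(j < n.+1) w j / (t j - s k) = 0.
  by rewrite /s; case: cid2.
have st (k : 'I_n) (j : nat) : t j - s k != 0.
  rewrite subr_eq0; have /andP[ks sk] := sI k.
  case: (leqP j k) => jk; rewrite neq_lt; apply/orP; [left|right].
    by apply: le_lt_trans ks; exact: t_mono.
  by apply: lt_le_trans sk _; exact: t_mono.
have s_incr (i j : 'I_n) : (i < j)%N -> s i < s j.
  move=> ij; have /andP[_ si] := sI i; have /andP[sj _] := sI j.
  by apply: (lt_trans si); apply: le_lt_trans sj; exact: t_mono.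
have s_inj : injective s.
  move=> i j e; apply: val_inj; case: (ltngtP i j) => // /s_incr;
  by rewrite e ltxx.
have s_seg k : s k \in `[t 0%N, t n].
  have /andP[ks sk] := sI k; rewrite in_itv/=; apply/andP; split.
    by apply: le_trans (ltW ks); exact: t_mono.
  by apply: (le_trans (ltW sk)); apply: t_mono.
pose slope (k : 'I_n) : R := \sum_(j < n.+1) w j / (t j - s k) ^+ 2.
have slope_gt0 k : 0 < slope k.
  rewrite /slope big_ord_recl ltr_pwDl//.
    by rewrite divr_gt0// exprn_even_gt0//= st.
  by apply: sumr_ge0 => j _; rewrite divr_ge0 ?ltW// exprn_even_gt0//= st.
have hzc : complex.Im (conjc z) != 0.
  by case: z hz {iz} => x y /= y0; rewrite oppr_eq0 gt_eqF.
have hz0 : complex.Im z != 0 by rewrite gt_eqF.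
pose m (k : 'I_n) : R :=
  (((s k - complex.Re z) ^+ 2 + complex.Im z ^+ 2) * slope k)^-1.
have mE k : (m k)%:C =
    (((s k)%:C - z) * ((s k)%:C - conjc z)
      * \sum_(j < n.+1) (w j)%:C / ((t j)%:C - (s k)%:C) ^+ 2)^-1.
  rewrite /m fmorphV; congr (_^-1); rewrite rmorphM; congr (_ * _).
    by case: z {iz hz hzc hz0 m} => x y /=; simpc; congr (_ +i* _); ring.
  rewrite rmorph_sum; apply: eq_bigr => j _.
  by rewrite fmorph_div rmorphXn rmorphB.
exists m, s; split.
  move=> k; split=> //; rewrite /m invr_ge0 mulr_ge0// ?(ltW (slope_gt0 k))//.
  by rewrite addr_ge0// sqr_ge0.
move=> x xI.
have x_neq r : r \in `[t 0%N, t n] -> x != r%:C.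
  by move=> rI; apply: contra_notN xI => /eqP ->; exists r.
have -> : stieltjes_sum m s x = \sum_k
    (((s k)%:C - z) * ((s k)%:C - conjc z)
      * \sum_(j < n.+1) (w j)%:C / ((t j)%:C - (s k)%:C) ^+ 2)^-1 / ((s k)%:C - x).
  by apply: eq_bigr => k _; rewrite mE.
have inj_C : injective (real_complex R) by move=> ? ? [].
apply: (inverse_partial_fractions n (fun j : 'I_n.+1 => (t j)%:C)
  (fun j : 'I_n.+1 => (w j)%:C) (fun k => (s k)%:C)).
- by move=> j k; rewrite (inj_eq inj_C) -subr_eq0.
- by move=> i j /inj_C/s_inj.
- case: z hz {iz hzc hz0 m mE} => u v /= v0; apply/eqP => -[] /eqP.
  by rewrite -subr_eq0 opprK -mulr2n mulrn_eq0/= gt_eqF.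
- by move=> k; exact: neq_real.
- by move=> k; exact: neq_real.
- by move=> j; exact: neq_real.
- by move=> j; exact: neq_real.
- move=> k; rewrite -[RHS](rmorph0 (real_complex R)) -(s0 k) rmorph_sum.
  by apply: eq_bigr => j _; rewrite fmorph_div rmorphB.
- move=> k.
  suff -> : \sum_(j < n.+1) (w j)%:C / ((t j)%:C - (s k)%:C) ^+ 2 = (slope k)%:C :> R[i].
    by rewrite fmorph_eq0 gt_eqF.
  rewrite rmorph_sum; apply: eq_bigr => j _.
  by rewrite fmorph_div rmorphXn rmorphB.
- exact: iz.
- transitivity (conjc (1 + phi z * (a2%:C * z - a1%:C))).
    rewrite rmorphD rmorphM rmorphB rmorphM.
    congr (_ + _ * (_ * _ - _)); rewrite /= ?oppr0 ?conjc1//.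
    exact: stieltjes_sum_conj.
  by rewrite iz conjc0.
- move=> j; apply: x_neq; rewrite in_itv/=.
  by apply/andP; split; apply: t_mono => //; exact: leq_ord.
- by move=> k; apply: x_neq.
Qed.

(** * Riemann-Stieltjes sums of Lipschitz functions *)

Definition lipschitz_itv {R : realType} (a b K : R) (f : R -> R) :=
  forall s t, s \in `[a, b] -> t \in `[a, b] -> `|f s - f t| <= K * `|s - t|.

(** The Riemann-Stieltjes sum of [f] against [F] over the nodes
    [x 0, ..., x N].  The first term accounts for a mass at [x 0]: it is the
    integral for a measure with cumulative distribution function [F]
    after every interval ]x_j, x_(j+1)] has been collapsed to its right end. *)
Definition rsum {R : realType} (f : R -> R) (x : nat -> R) (N : nat) (F : R -> R) : R :=
  F (x 0%N) * f (x 0%N) + \sum_(j < N) (F (x j.+1) - F (x j)) * f (x j.+1).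

Section RiemannSums.
Context {R : realType}.
Implicit Types (f F G : R -> R) (x : nat -> R) (N : nat).

Lemma rsumS f x N F :
  rsum f x N.+1 F = rsum f x N F + (F (x N.+1) - F (x N)) * f (x N.+1).
Proof. by rewrite /rsum big_ord_recr/= addrA. Qed.

Lemma rsum_parts f x N F :
  rsum f x N F = F (x N) * f (x N) - \sum_(j < N) F (x j) * (f (x j.+1) - f (x j)).
Proof.
elim: N => [|N IH]; first by rewrite /rsum !big_ord0 subr0 addr0.
rewrite rsumS IH big_ord_recr/=; ring.
Qed.

Lemma rsumD f x N F G (c : R) :
  rsum f x N (fun y => F y + c * G y) = rsum f x N F + c * rsum f x N G.
Proof.
elim: N => [|N IH]; first by rewrite /rsum !big_ord0; ring.
by rewrite !rsumS IH; ring.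
Qed.

Lemma rsum_sum f x N n (m : 'I_n -> R) (F : 'I_n -> R -> R) :
  rsum f x N (fun y => \sum_k m k * F k y) = \sum_k m k * rsum f x N (F k).
Proof.
elim: N => [|N IH].
  rewrite /rsum big_ord0 addr0 mulr_suml; apply: eq_bigr => k _.
  by rewrite big_ord0 addr0 mulrA.
rewrite rsumS IH -sumrB mulr_suml -big_split/=; apply: eq_bigr => k _.
by rewrite rsumS; ring.
Qed.

(** The error estimate for a unit mass at [t]: the sum evaluates [f] at the first
    node that is at least [t].  The estimates for discrete sums and for
    integrals follow by linearity in the measure. *)
Lemma rsum_heaviside_err (b K d : R) f x N (t : R) :
  {homo x : i j / (i <= j)%N >-> i <= j} ->
  (forall j, (j < N)%N -> x j.+1 - x j <= d) -> 0 <= d -> 0 <= K ->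
  x N <= b -> lipschitz_itv (x 0%N) b K f -> x 0%N <= t <= x N ->
  `|f t - rsum f x N (fun y => (t <= y)%R%:R)| <= K * d.
Proof.
move=> x_mono xd d0 K0 xb fK; elim: N xd xb => [|N IH] xd xb /andP[x0t txN].
  have -> : t = x 0%N by apply/le_anti; rewrite x0t txN.
  by rewrite /rsum big_ord0 addr0 lexx mul1r subrr normr0 mulr_ge0.
rewrite rsumS txN.
have [tN|Nt] := leP t (x N).
  rewrite subrr mul0r addr0; apply: IH; last by rewrite x0t.
    by move=> j jN; apply: xd; rewrite ltnS ltnW.
  by apply: le_trans xb; exact: x_mono.
have -> : rsum f x N (fun y : R => (t <= y)%R%:R) = 0.
  have xt j : (j <= N)%N -> (t <= x j) = false.
    by move=> jN; apply/negbTE; rewrite -ltNge; apply: le_lt_trans Nt; exact: x_mono.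
  rewrite /rsum xt// mul0r add0r big1// => j _.
  by rewrite !xt ?subrr ?mul0r// ltnW.
rewrite add0r subr0 mul1r; apply: (le_trans (fK _ _ _ _)).
- by rewrite in_itv/= x0t (le_trans txN).
- by rewrite in_itv/= xb andbT x_mono.
- rewrite ler_wpM2l// distrC ger0_norm ?subr_ge0//.
  by apply: le_trans (xd N _) => //; rewrite lerD2l lerN2 ltW.
Qed.

(** Right regularization moves a cumulative function by less than its next
    increment, so that it hardly changes the sum, even when nodes are
    discontinuity points.  Summation by parts turns the difference of the sums
    into a sum of these moves, which telescopes. *)
Lemma rsum_sandwich (K d : R) f x N F G :
  {homo x : i j / (i <= j)%N >-> i <= j} ->
  (forall j, (j < N)%N -> x j.+1 - x j <= d) -> 0 <= d -> 0 <= K ->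
  lipschitz_itv (x 0%N) (x N) K f ->
  (forall j, (j < N)%N -> F (x j) <= G (x j) <= F (x j.+1)) ->
  F (x N) = G (x N) ->
  `|rsum f x N F - rsum f x N G| <= K * d * (F (x N) - F (x 0%N)).
Proof.
move=> x_mono xd d0 K0 fK FG FGN.
have -> : rsum f x N F - rsum f x N G
    = \sum_(j < N) (G (x j) - F (x j)) * (f (x j.+1) - f (x j)).
  rewrite !rsum_parts FGN opprB addrC addrA subrK -sumrB.
  by apply: eq_bigr => j _; rewrite mulrBl.
rewrite -(telescope_sumr (fun j => F (x j)))// big_mkord mulr_sumr.
apply: (le_trans (ler_norm_sum _ _ _)); apply: ler_sum => j _.
have /andP[FGj GFj] := FG j (ltn_ord j).
rewrite normrM mulrC ler_pM//.
  apply: (le_trans (fK _ _ _ _)).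
  - by rewrite in_itv/= !x_mono.
  - by rewrite in_itv/= !x_mono// ltnW.
  - by rewrite ler_wpM2l// ger0_norm ?xd// subr_ge0 x_mono.
by rewrite ger0_norm ?subr_ge0// lerD2r.
Qed.

Lemma rsum_bound (B : R) f x N F :
  {homo x : i j / (i <= j)%N >-> i <= j} -> {homo F : u v / u <= v} ->
  0 <= F (x 0%N) -> (forall j, (j <= N)%N -> `|f (x j)| <= B) ->
  `|rsum f x N F| <= B * F (x N).
Proof.
move=> x_mono F_mono F0 fB.
have -> : B * F (x N) =
    F (x 0%N) * B + \sum_(j < N) (F (x j.+1) - F (x j)) * B.
  rewrite -mulr_suml -(big_mkord xpredT (fun j => F (x j.+1) - F (x j))).
  by rewrite telescope_sumr// -mulrDl addrC subrK mulrC.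
apply: (le_trans (ler_normD _ _)); rewrite lerD//.
  by rewrite normrM (ger0_norm F0) ler_wpM2l// fB.
apply: (le_trans (ler_norm_sum _ _ _)); apply: ler_sum => j _.
have dF : 0 <= F (x j.+1) - F (x j) by rewrite subr_ge0 F_mono// x_mono.
by rewrite normrM (ger0_norm dF) ler_wpM2l// fB.
Qed.

End RiemannSums.

Section RiemannSumsIntegral.
Context {R : realType}.
Variable mu : {finite_measure set (measurableTypeR R) -> \bar R}.
Implicit Types (D : set R) (f : R -> R).

Lemma bounded_integrable D f (B : R) : measurable (D : set (measurableTypeR R)) ->
  measurable_fun D (f : measurableTypeR R -> R) -> (forall t, D t -> `|f t| <= B) ->
  mu.-integrable D (EFin \o f).
Proof.
move=> mD mf fB; apply: measurable_bounded_integrable => //.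
  by rewrite ltey_eq fin_num_measure.
exists B; split; first exact: num_real.
by move=> y By t Dt /=; apply: (le_trans (fB t Dt)); exact: ltW.
Qed.

Definition cdf_on D (y : R) : R := fine (mu (D `&` `]-oo, y])).

Let heaviside_indic (y : R) :
  (fun t : R => (t <= y)%R%:R) = \1_`]-oo, y]%classic :> (R -> R).
Proof. by apply/funext => t; rewrite indicE mem_setE in_itv/=. Qed.

Lemma integrable_heaviside D y : measurable (D : set (measurableTypeR R)) ->
  mu.-integrable D (EFin \o (fun t : R => (t <= y)%R%:R)).
Proof.
move=> mD; apply: (@bounded_integrable _ _ 1) => //.
  by rewrite heaviside_indic; exact: measurable_indic.
by move=> t _; rewrite normr_nat lern1 leq_b1.
Qed.

Lemma Rintegral_heaviside D y : measurable (D : set (measurableTypeR R)) ->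
  \int[mu]_(t in D) (t <= y)%R%:R = cdf_on D y :> R.
Proof.
move=> mD; rewrite /Rintegral /cdf_on setIC.
by under eq_integral do rewrite -[(_ <= _)%R%:R]/((fun t => (t <= y)%R%:R) _)
  heaviside_indic; rewrite integral_indic.
Qed.

(** Averaging over the unit mass at [t] turns its sum into the sum for [mu]. *)
Lemma Rintegral_rsum D f (x : nat -> R) N : measurable (D : set (measurableTypeR R)) ->
  mu.-integrable D (EFin \o (fun t : R => rsum f x N (fun y => (t <= y)%R%:R))) /\
  \int[mu]_(t in D) rsum f x N (fun y => (t <= y)%R%:R) = rsum f x N (cdf_on D).
Proof.
move=> mD.
have iH c y : mu.-integrable D (EFin \o (fun t : R => (t <= y)%R%:R * c)).
  exact: (integrableZr mD c (integrable_heaviside D y mD)).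
have IH c y : \int[mu]_(t in D) ((t <= y)%R%:R * c) = cdf_on D y * c :> R.
  by rewrite RintegralZr ?Rintegral_heaviside//; exact: integrable_heaviside.
elim: N => [|N [iN IN]].
  rewrite /rsum big_ord0 addr0 -IH; split.
    apply: eq_integrable (iH (f (x 0%N)) (x 0%N)) => // t _ /=.
    by rewrite big_ord0 addr0.
  by apply: eq_Rintegral => t _; rewrite big_ord0 addr0.
have iS := integrableB mD (iH (f (x N.+1)) (x N.+1)) (iH (f (x N.+1)) (x N)).
split.
  apply: eq_integrable (integrableD mD iN iS) => // t _ /=.
  by rewrite rsumS mulrBl.
rewrite rsumS mulrBl -!IH -IN -RintegralB// -RintegralD//.
by apply: eq_Rintegral => t _; rewrite rsumS mulrBl.
Qed.

Lemma rsum_integral_err (K d : R) f (x : nat -> R) N :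
  {homo x : i j / (i <= j)%N >-> i <= j} ->
  (forall j, (j < N)%N -> x j.+1 - x j <= d) -> 0 <= d -> 0 <= K ->
  lipschitz_itv (x 0%N) (x N) K f ->
  let D : set (measurableTypeR R) := `[x 0%N, x N]%classic in
  mu.-integrable D (EFin \o f) ->
  `|\int[mu]_(t in D) f t - rsum f x N (cdf_on D)| <= K * d * fine (mu D).
Proof.
move=> x_mono xd d0 K0 fK D fi.
have mD : measurable D by exact: measurable_itv.
have [hi <-] := Rintegral_rsum D f x N mD.
have fhi := integrableB mD fi hi.
rewrite -RintegralB//; apply: (le_trans (le_normr_Rintegral _ _)) => //.
rewrite -Rintegral_cst//; apply: le_Rintegral => //.
- exact: integrable_norm.
- by apply: (@bounded_integrable _ _ `|K * d|) => //; exact: measurable_cst.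
- move=> t; rewrite /D/= in_itv/= => tI.
  exact: rsum_heaviside_err tI.
Qed.

End RiemannSumsIntegral.

(** * Compactness of discrete measures with bounded mass *)

Lemma lipschitz_itv_bounded (R : realType) (a b K : R) (f : R -> R) (t : R) :
  a <= b -> 0 <= K -> lipschitz_itv a b K f -> t \in `[a, b] ->
  `|f t| <= `|f a| + K * (b - a).
Proof.
move=> ab K0 fK tI.
have aI : a \in `[a, b] by rewrite in_itv/= lexx.
have := fK t a tI aI; move: tI; rewrite in_itv/= => /andP[at_ tb] ft.
rewrite -[f t](subrK (f a)) addrC (le_trans (ler_normD _ _))// lerD2l.
apply: (le_trans ft); rewrite ler_wpM2l// ger0_norm ?subr_ge0//.
by rewrite lerD2r.
Qed.

Lemma lipschitz_integrable (R : realType)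
    (mu : {finite_measure set (measurableTypeR R) -> \bar R}) (a b K : R) (f : R -> R) :
  a <= b -> 0 <= K -> lipschitz_itv a b K f -> mu.-integrable `[a, b]%classic (EFin \o f).
Proof.
move=> ab K0 fK.
apply: (@bounded_integrable _ _ _ _ (`|f a| + K * (b - a))).
- exact: measurable_itv.
- (* Clamping to the segment extends f to a function continuous on the line. *)
  pose c (t : R) := Num.max a (Num.min t b).
  have cI t : c t \in `[a, b].
    by rewrite in_itv/= le_max lexx ge_max ab ge_min lexx orbT.
  have cc s t : `|c s - c t| <= `|s - t|.
    have st := ler_norm (s - t); have ts := ler_norm (t - s).
    rewrite distrC in ts; rewrite ler_norml /c /Num.max /Num.min.
    by case: (ltP s b) => sb; case: (ltP t b) => tb; apply/andP; split;
      do ! case: ltP => ?; lra.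
  apply: (@eq_measurable_fun _ _ _ _ _ (f \o c)).
    move=> t; rewrite inE/= in_itv/= /c => /andP[at_ tb].
    by rewrite (min_idPl tb) (max_idPr at_).
  apply: measurable_funTS; apply: continuous_measurable_fun => t.
  apply/cvgrPdist_le => e e0.
  have K1 : 0 < K + 1 by rewrite ltr_wpDl.
  near=> s; apply: (le_trans (fK _ _ (cI _) (cI _))).
  apply: (@le_trans _ _ ((K + 1) * `|t - s|)).
    by rewrite ler_pM// ?lerDl// cc.
  rewrite mulrC -ler_pdivlMr//.
  near: s; apply: cvgr_dist_le; first exact: cvg_id.
  by rewrite divr_gt0.
- by move=> t tI; exact: lipschitz_itv_bounded.
Unshelve. all: end_near. Qed.

(** The Lebesgue-Stieltjes measure is prescribed on the intervals ]u, v]; the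
    closed left end [a] is reached because [G] vanishes on ]-oo, a[, so that
    the measure does not charge this interval. *)
Lemma exists_measure_of_cdf (R : realType) (a b : R) (G : R -> R) :
  a <= b -> {homo G : x y / x <= y} ->
  (forall x : R, G @ x^'+ --> G x) -> (forall x, x < a -> G x = 0) ->
  exists mu : {finite_measure set (measurableTypeR R) -> \bar R},
    mu (~` `[a, b]%classic) = 0%E /\
    forall y, y \in `[a, b] -> cdf_on mu `[a, b]%classic y = G y.
Proof.
move=> ab G_mono G_rc G0.
pose Gc : cumulative R R := HB.pack G (isCumulative.Build R _ R G G_mono G_rc).
pose ls : {measure set (measurableTypeR R) -> \bar R} := lebesgue_stieltjes_measure Gc.
have lsE u v : u <= v -> ls `]u, v]%classic = (G v - G u)%:E.
  move=> uv; rewrite /ls/= /lebesgue_stieltjes_measure.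
  rewrite /measure_extension measurable_mu_extE/=; last exact: is_ocitv.
  by rewrite wlength_itv_bnd.
have ls_lt_a : ls `]a - 2, a[%classic = 0%E.
  apply: measure_negligible; first exact: measurable_itv.
  apply: (@negligibleS _ _ _ ls
    (\bigcup_n `]a - 2, a - n.+1%:R^-1]%classic)).
    move=> t /=; rewrite in_itv/= => /andP[at_ ta].
    have [n nt] : exists n : nat, n.+1%:R^-1 < a - t.
      exists (Num.truncn (a - t)^-1); rewrite invf_plt ?posrE ?subr_gt0//.
      by rewrite truncnS_gt.
    by exists n => //=; rewrite in_itv/= at_/= lerBrDr addrC -lerBrDr ltW.
  apply: negligible_bigcup => n; apply/negligibleP; first exact: measurable_itv.
  have : (n.+1%:R^-1 : R) <= 1 by rewrite invf_le1 ?ler1n.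
  have : (0 : R) < n.+1%:R^-1 by rewrite invr_gt0.
  move: n.+1%:R^-1 => e e0 e1.
  rewrite -[LHS]/(ls `]a - 2, a - e]%classic) lsE; last by lra.
  by rewrite !G0 ?subrr//; lra.
have ls_ay y : a <= y -> ls `[a, y]%classic = (G y)%:E.
  move=> ay; have := lsE (a - 2) y; rewrite (G0 (a - 2)) ?subr0; last by lra.
  move=> <-; last by lra.
  have -> : `]a - 2, y]%classic = `]a - 2, a[%classic `|` `[a, y]%classic.
    by rewrite -itv_bndbnd_setU// bnd_simp; lra.
  transitivity (ls `](a - 2)%R, a[%classic + ls `[a, y]%classic)%E.
    by rewrite ls_lt_a add0e.
  symmetry; apply: measureU; [exact: measurable_itv|exact: measurable_itv|].
  apply/seteqP; split => t //=; rewrite !in_itv/= => -[/andP[_ ta] /andP[at_ _]].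
  by move: (lt_le_trans ta at_); rewrite ltxx.
have mD : measurable (`[a, b]%classic : set (measurableTypeR R)) by exact: measurable_itv.
have Dfin : (ls `[a, b]%classic < +oo)%E by rewrite ls_ay// ltry.
exists (mfrestr mD Dfin); split.
  by rewrite -[LHS]/(ls (~` `[a, b]%classic `&` `[a, b]%classic)) setICl measure0.
move=> y; rewrite in_itv/= => /andP[ay yb].
rewrite -[LHS]/(fine (ls (`[a, b]%classic `&` `]-oo, y]%classic `&` `[a, b]%classic))).
have -> : `[a, b] `&` `]-oo, y] `&` `[a, b] = `[a, y]%classic :> set R.
  apply/seteqP; split => t /=; rewrite !in_itv/=; first by case=> -[/andP[-> _] ->].
  by move=> /andP[-> ty]; rewrite ty (le_trans ty yb).
by rewrite ls_ay.
Qed.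

Definition grid {R : realType} (a b : R) (N j : nat) : R :=
  a + j%:R * ((b - a) / N.+1%:R).

Section Grid.
Context {R : realType}.
Variables (a b : R) (N : nat).

Lemma grid0 : grid a b N 0 = a.
Proof. by rewrite /grid mul0r addr0. Qed.

Lemma grid_last : grid a b N N.+1 = b.
Proof. by rewrite /grid mulrCA divff ?mulr1 ?subrKC// pnatr_eq0. Qed.

Lemma grid_step j : grid a b N j.+1 - grid a b N j = (b - a) / N.+1%:R.
Proof. rewrite /grid -addn1 natrD; ring. Qed.

Lemma grid_incr : a < b -> {homo grid a b N : i j / (i < j)%N >-> i < j}.
Proof.
move=> ab i j ij; rewrite /grid ltrD2l ltr_pM2r ?ltr_nat//.
by rewrite divr_gt0// subr_gt0.
Qed.

Lemma grid_mono : a < b -> {homo grid a b N : i j / (i <= j)%N >-> i <= j}.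
Proof. by move=> /grid_incr/ltW_homo. Qed.

Lemma grid_seg j : a < b -> (j <= N.+1)%N -> grid a b N j \in `[a, b].
Proof.
move=> ab jN; have gm := grid_mono ab.
by rewrite in_itv/=; have := gm 0%N j; have := gm j N.+1; rewrite grid0 grid_last => -> // ->.
Qed.

End Grid.

Lemma mesh_small (R : realType) (c e : R) : 0 < e -> exists N : nat, c / N.+1%:R <= e.
Proof.
move=> e0; exists (Num.truncn (`|c| / e)).
rewrite ler_pdivrMr// (le_trans (ler_norm c))// mulrC -ler_pdivrMr//.
by rewrite ltW// truncnS_gt.
Qed.

(** Limits along an ultrafilter stand in for the extraction of subsequences: all
    bounded sequences converge along the same one. *)
Lemma ultra_cvg_bounded (R : realType) (U : set_system nat) (u : nat -> R) (B : R) :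
  UltraFilter U -> (forall n, 0 <= u n <= B) -> exists l : R, u @ U --> l.
Proof.
move=> UU uB.
have [|p [_ pu]] := @segment_compact R 0 B (fmap u U).
  by apply: (@filterE _ U) => n; rewrite /= in_itv/= uB.
exists p => V Vp; have [//|UV] := in_ultra_setVsetC (u @^-1` V) UU.
by have [x [nVx Vx]] := pu (~` V) V UV Vp.
Qed.

Lemma rsum_cvg (R : realType) (U : set_system nat) (f : R -> R) (x : nat -> R)
    (N : nat) (Fn : nat -> R -> R) (F : R -> R) : Filter U ->
  (forall y, Fn n y @[n --> U] --> F y) ->
  rsum f x N (Fn n) @[n --> U] --> rsum f x N F.
Proof.
move=> FU FnF; elim: N => [|N IH].
  rewrite /rsum big_ord0 addr0; under eq_fun do rewrite big_ord0 addr0.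
  exact: cvgMl.
rewrite rsumS; under eq_fun do rewrite rsumS.
apply: cvgD => //; apply: cvgMl; exact: cvgB.
Qed.

Section RightRegularization.
Context {R : realType}.
Variable F : R -> R.
Hypothesis F_mono : {homo F : x y / x <= y}.
Hypothesis F_ge0 : forall x, 0 <= F x.

Definition right_reg (x : R) : R := inf [set F y | y in `]x, +oo[].

Lemma right_reg_ge x : F x <= right_reg x.
Proof.
apply: lb_le_inf; first by exists (F (x + 1)), (x + 1) => //=; rewrite in_itv/= ltrDl ltr01.
by move=> _ /= [y + <-]; rewrite in_itv/= andbT => xy; rewrite F_mono// ltW.
Qed.

Lemma right_reg_le x y : x < y -> right_reg x <= F y.
Proof.
move=> xy; apply: ge_inf; last by exists y => //=; rewrite in_itv/= xy.
by exists 0 => _ [u _ <-].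
Qed.

Lemma right_reg_mono : {homo right_reg : x y / x <= y}.
Proof.
move=> x y; rewrite le_eqVlt => /predU1P[->//|xy].
exact: le_trans (right_reg_le _ _ xy) (right_reg_ge y).
Qed.

Lemma right_reg_rc (x : R) : right_reg @ x^'+ --> right_reg x.
Proof.
apply/cvgrPdist_le => e e0.
have [_ [y + <-] Fy] : exists2 v, [set F y | y in `]x, +oo[] v & v < right_reg x + e.
  apply: inf_adherent => //; split.
    by exists (F (x + 1)), (x + 1) => //=; rewrite in_itv/= ltrDl ltr01.
  by exists 0 => _ [u _ <-].
rewrite /= in_itv/= andbT => xy.
near=> u.
have xu : x < u by near: u; exact: nbhs_right_gt.
have uy : u < y by near: u; exact: nbhs_right_lt.
have xu_le := right_reg_mono _ _ (ltW xu).
rewrite distrC ger0_norm ?subr_ge0// lerBlDl.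
by rewrite (le_trans (right_reg_le _ _ uy))// ltW.
Unshelve. all: end_near. Qed.

End RightRegularization.

Section Helly.
Context {R : realType}.
Variables (a b B : R) (p : nat -> nat) (m s : forall n, 'I_(p n) -> R).
Arguments m : clear implicits.
Arguments s : clear implicits.
Hypothesis ab : a < b.
Hypothesis m_ge0 : forall n k, 0 <= m n k.
Hypothesis s_seg : forall n k, s n k \in `[a, b].
Hypothesis m_bnd : forall n, \sum_k m n k <= B.

Let D : set (measurableTypeR R) := `[a, b]%classic.
Let Fn n (y : R) : R := \sum_k m n k * (s n k <= y)%R%:R.

Let Fn_bnd n y : 0 <= Fn n y <= B.
Proof.
rewrite sumr_ge0/=; last by move=> k _; rewrite mulr_ge0.
apply: le_trans (m_bnd n); apply: ler_sum => k _.
by rewrite ler_piMr// lern1 leq_b1.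
Qed.

Let Fn_mono n : {homo Fn n : x y / x <= y}.
Proof.
move=> x y xy; apply: ler_sum => k _; rewrite ler_wpM2l//.
by case: (leP (s n k) x) => [sx|_]; [rewrite (le_trans sx xy)|exact: ler0n].
Qed.

(** Helly's selection theorem, for discrete measures on a segment with bounded
    masses: the cumulative functions converge pointwise along an ultrafilter,
    and the right regularization of the limit is the cumulative function of the
    limit measure. *)
Lemma helly : exists U : set_system nat,
  [/\ ProperFilter U, \oo `<=` U &
   exists mu : {finite_measure set (measurableTypeR R) -> \bar R},
     mu (~` D) = 0%E /\
     forall f K, 0 <= K -> lipschitz_itv a b K f ->
       \sum_k m n k * f (s n k) @[n --> U] --> (\int[mu]_(t in D) f t : R)].
Proof.
have [U [UU ooU]] := @ultraFilterLemma nat \oo _.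
exists U; split => //; first exact: ultra_proper.
have /choice[F FnF] y : exists l : R, Fn n y @[n --> U] --> l.
  exact: (@ultra_cvg_bounded _ U _ B).
have F_mono : {homo F : x y / x <= y}.
  move=> x y xy; apply: (ler_cvg_to (FnF x) (FnF y)).
  by apply: filterE => n; exact: Fn_mono.
have F_ge0 x : 0 <= F x.
  apply: (cvgr_to_ge (FnF x)); apply: filterE => n.
  by have /andP[] := Fn_bnd n x.
have F_le x : F x <= B.
  apply: (cvgr_to_le (FnF x)); apply: filterE => n.
  by have /andP[] := Fn_bnd n x.
have F_eq x y : (forall n, Fn n x = Fn n y) -> F x = F y.
  move=> xy; apply: (cvg_unique _ (FnF x)) => //.
  suff -> : (fun n => Fn n x) = fun n => Fn n y by exact: FnF.
  exact/funext.
have F0 x : x < a -> F x = 0.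
  move=> xa; apply: (cvg_unique _ (FnF x)) => //.
  suff -> : (fun n => Fn n x) = fun=> 0 by exact: cvg_cst.
  apply/funext => n; rewrite /Fn big1// => k _.
  have := s_seg n k; rewrite in_itv/= => /andP[ask _].
  by rewrite leNgt (lt_le_trans xa ask)/= mulr0.
have Fb y : b <= y -> F y = F b.
  move=> b_y; apply: F_eq => n; apply: eq_bigr => k _.
  have := s_seg n k; rewrite in_itv/= => /andP[_ skb].
  by rewrite skb (le_trans skb b_y).
pose G := right_reg F.
have FG x : F x <= G x by exact: right_reg_ge.
have GF x y : x < y -> G x <= F y by exact: right_reg_le.
have [mu [muD muG]] : exists mu : {finite_measure set (measurableTypeR R) -> \bar R},
    mu (~` D) = 0%E /\ forall y, y \in `[a, b] -> cdf_on mu D y = G y.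
  apply: exists_measure_of_cdf.
  - exact: ltW.
  - exact: right_reg_mono.
  - exact: right_reg_rc.
  - move=> x xa; apply/le_anti; rewrite (le_trans (F_ge0 x) (FG x)) andbT.
    by rewrite -(F0 ((x + a) / 2)); [apply: GF; lra|lra].
have Gb : F b = G b.
  by apply/le_anti; rewrite FG/= -(Fb (b + 1)) ?GF//; lra.
exists mu; split => // f K K0 fK.
apply/cvgrPdist_le => e e0.
(* e / 4 for each of: sums to Riemann sums of Fn, of Fn to those of F, of F to
   those of G, and of G to the integral. *)
have [N Ne] := mesh_small R (K * (b - a) * B) (e / 4) ltac:(lra).
pose d := (b - a) / N.+1%:R.
have d0 : 0 <= d by rewrite /d divr_ge0// subr_ge0 ltW.
have KdB c : c <= B -> K * d * c <= e / 4.
  move=> cB; apply: le_trans Ne; rewrite /d mulrA -mulrA.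
  by rewrite [_^-1 * _]mulrC mulrA ler_wpM2r// ler_wpM2l// mulr_ge0// subr_ge0 ltW.
pose x := grid a b N.
have x0 : x 0%N = a by exact: grid0.
have xN : x N.+1 = b by exact: grid_last.
have x_mono : {homo x : i j / (i <= j)%N >-> i <= j} by exact: grid_mono.
have xd j : x j.+1 - x j <= d by rewrite /x grid_step.
have x_seg j : (j <= N.+1)%N -> x j \in `[a, b].
  exact: grid_seg.
have fi : mu.-integrable D (EFin \o f).
  by apply: (@lipschitz_integrable _ _ a b K) => //; exact: ltW.
have err_mu : `|\int[mu]_(t in D) f t - rsum f x N.+1 G| <= e / 4.
  have <- : rsum f x N.+1 (cdf_on mu D) = rsum f x N.+1 G.
    rewrite /rsum muG ?x_seg//; congr (_ + _); apply: eq_bigr => j _.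
    by rewrite !muG ?x_seg// ltnW// ltnS.
  have := @rsum_integral_err _ mu K d f x N.+1 x_mono (fun j _ => xd j) d0 K0.
  rewrite x0 xN => /(_ fK fi) /le_trans; apply; apply: KdB.
  have -> : fine (mu D) = G b.
    rewrite -muG ?in_itv/= ?lexx ?ltW// /cdf_on; congr (fine (mu _)).
    by apply/seteqP; split => [t|t []//]; rewrite /D/= !in_itv/= => /andP[-> ->].
  by rewrite -Gb.
have err_FG : `|rsum f x N.+1 F - rsum f x N.+1 G| <= e / 4.
  apply: (le_trans (@rsum_sandwich _ K d f x N.+1 F G x_mono (fun j _ => xd j) d0 K0 _ _ _)).
  - by rewrite x0 xN.
  - by move=> j _; rewrite FG/= GF// grid_incr.
  - by rewrite xN.
  - by rewrite KdB// xN x0 (le_trans _ (F_le b))// gerBl.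
have err_Fn n : `|\sum_k m n k * f (s n k) - rsum f x N.+1 (Fn n)| <= e / 4.
  rewrite rsum_sum -sumrB; apply: (le_trans (ler_norm_sum _ _ _)).
  apply: le_trans (KdB _ (m_bnd n)); rewrite mulr_sumr; apply: ler_sum => k _.
  rewrite -mulrBr normrM (ger0_norm (m_ge0 n k)) mulrC ler_wpM2r//.
  apply: (@rsum_heaviside_err _ b) => //; rewrite ?x0 ?xN//.
  by have := s_seg n k; rewrite in_itv.
have e4 : 0 < e / 4 by rewrite divr_gt0.
have cvg_rsum : rsum f x N.+1 (Fn n) @[n --> U] --> rsum f x N.+1 F.
  exact: rsum_cvg.
have /cvgrPdist_le/(_ _ e4) := cvg_rsum.
apply: filterS => n errFn.
have := err_Fn n; move: err_mu err_FG errFn.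
rewrite !ler_norml => /andP[? ?] /andP[? ?] /andP[? ?] /andP[? ?].
by apply/andP; split; lra.
Qed.

End Helly.

(** * The kernel 1 / (t - x) off the segment *)

Section Resolvent.
Context {R : realType}.
Implicit Types (a b t : R) (x : R[i]).

Lemma Re_resolvent t x : complex.Re ((t%:C - x)^-1) =
  (t - complex.Re x) / ((t - complex.Re x) ^+ 2 + complex.Im x ^+ 2).
Proof. by case: x => u v /=; rewrite add0r sqrrN. Qed.

Lemma Im_resolvent t x : complex.Im ((t%:C - x)^-1) =
  complex.Im x / ((t - complex.Re x) ^+ 2 + complex.Im x ^+ 2).
Proof. by case: x => u v /=; rewrite add0r sqrrN mulNr opprK. Qed.

Lemma sqr_dist_ge a b x : (~` real_segment a b) x ->
  exists2 c, 0 < c & forall t, t \in `[a, b] ->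
    c <= (t - complex.Re x) ^+ 2 + complex.Im x ^+ 2.
Proof.
case: x => u v xI /=.
have [v0|v0] := eqVneq v 0; last first.
  exists (v ^+ 2); first by rewrite exprn_even_gt0.
  by move=> t _; rewrite lerDr sqr_ge0.
have : u \notin `[a, b].
  by apply/negP => uI; apply: xI; exists u => //; rewrite v0.
rewrite in_itv/= negb_and -!ltNge => /orP[ua|bu].
  exists ((a - u) ^+ 2); first by rewrite exprn_gt0// subr_gt0.
  by move=> t; rewrite in_itv/= => /andP[at_ tb]; rewrite v0; nra.
exists ((u - b) ^+ 2); first by rewrite exprn_gt0// subr_gt0.
by move=> t; rewrite in_itv/= => /andP[at_ tb]; rewrite v0; nra.
Qed.

Lemma itv_dist_le a b t (u : R) : t \in `[a, b] -> `|t - u| <= `|a| + `|b| + `|u|.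
Proof.
rewrite in_itv/= => /andP[at_ tb].
apply: (le_trans (ler_normB _ _)); rewrite lerD2r.
have := ler_norm a; have := ler_norm b; have := ler_norm (- a).
have := normr_ge0 a; have := normr_ge0 b; rewrite normrN.
by case: (ger0P t) => _; lra.
Qed.

Lemma resolvent_lipschitz a b x : a <= b -> (~` real_segment a b) x ->
  exists2 K, 0 <= K &
    lipschitz_itv a b K (fun t => complex.Re ((t%:C - x)^-1)) /\
    lipschitz_itv a b K (fun t => complex.Im ((t%:C - x)^-1)).
Proof.
move=> ab /sqr_dist_ge[c c0 cP].
pose u := complex.Re x; pose v := complex.Im x.
pose C := `|a| + `|b| + `|u|.
have tC t (tI : t \in `[a, b]) : `|t - u| <= C := itv_dist_le _ _ _ _ tI.
have C0 : 0 <= C by rewrite /C !addr_ge0.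
pose q t := (t - u) ^+ 2 + v ^+ 2.
have q_neq0 t : t \in `[a, b] -> q t != 0.
  by move=> /cP/(lt_le_trans c0); rewrite lt0r => /andP[].
have qq s t : s \in `[a, b] -> t \in `[a, b] -> c ^+ 2 <= q s * q t.
  by move=> /cP qs /cP qt; rewrite expr2 ler_pM// ltW.
pose A := v ^+ 2 + C ^+ 2 + 2 * `|v| * C.
have A0 : 0 <= A.
  by rewrite /A !addr_ge0 ?sqr_ge0// !mulr_ge0.
have bnd n s t : s \in `[a, b] -> t \in `[a, b] -> `|n| <= A * `|s - t| ->
    `|n / (q s * q t)| <= A / c ^+ 2 * `|s - t|.
  move=> sI tI nA; rewrite normrM mulrAC ler_pM// normfV.
  have c2 : 0 < c ^+ 2 by rewrite exprn_gt0.
  have qq0 := lt_le_trans c2 (qq _ _ sI tI).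
  by rewrite (gtr0_norm qq0) lef_pV2// ?posrE// qq.
have quad s t : s \in `[a, b] -> t \in `[a, b] -> `|(s - u) * (t - u)| <= C ^+ 2.
  by move=> sI tI; rewrite normrM expr2 ler_pM// tC.
exists (A / c ^+ 2); first by rewrite divr_ge0// sqr_ge0.
split=> s t sI tI.
  rewrite !Re_resolvent -/u -/v -/(q s) -/(q t).
  have -> : (s - u) / q s - (t - u) / q t =
      ((v ^+ 2 - (s - u) * (t - u)) * (s - t)) / (q s * q t).
    have := q_neq0 s sI; have := q_neq0 t tI; rewrite /q => qt qs.
    by field; rewrite qt qs.
  apply: bnd => //; rewrite normrM ler_wpM2r//.
  apply: (le_trans (ler_normB _ _)); rewrite (ger0_norm (sqr_ge0 _)).
  apply: (@le_trans _ _ (v ^+ 2 + C ^+ 2)); first by rewrite lerD2l quad.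
  by rewrite /A lerDl !mulr_ge0.
rewrite !Im_resolvent -/u -/v -/(q s) -/(q t).
have -> : v / q s - v / q t =
    (v * ((t - u) + (s - u)) * (t - s)) / (q s * q t).
  have := q_neq0 s sI; have := q_neq0 t tI; rewrite /q => qt qs.
  by field; rewrite qt qs.
apply: bnd => //; rewrite normrM (distrC t s) ler_wpM2r//.
rewrite normrM; apply: (@le_trans _ _ (2 * `|v| * C)).
  rewrite -mulrA mulrCA ler_wpM2l// (le_trans (ler_normD _ _))//.
  by rewrite mulr2n mulrDl mul1r lerD// tC.
by rewrite /A lerDr addr_ge0 ?sqr_ge0.
Qed.

(** This makes the imaginary part of a Markov function at a point of the upper
    half plane comparable with the total mass. *)
Lemma Im_resolvent_ge a b x : 0 < complex.Im x ->
  exists2 c, 0 < c & forall t, t \in `[a, b] -> c <= complex.Im ((t%:C - x)^-1).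
Proof.
case: x => u v /= v0.
pose C := (`|a| + `|b| + `|u|) ^+ 2 + v ^+ 2.
have C0 : 0 < C by rewrite /C ltr_wpDl ?sqr_ge0// exprn_gt0.
exists (v / C); first by rewrite divr_gt0.
move=> t tI.
rewrite -[X in _ <= X]/(complex.Im ((t%:C - (u +i* v))^-1)) Im_resolvent/=.
rewrite ler_pM2l// lef_pV2 ?posrE//; last first.
  by rewrite ltr_wpDl ?sqr_ge0// exprn_gt0.
rewrite /C lerD2r -[leLHS]real_normK ?num_real//.
by rewrite ler_pXn2r ?nnegrE ?addr_ge0// itv_dist_le.
Qed.

End Resolvent.

(** * Convergence in the complex plane *)

Section ComplexLimits.
Context {R : realType} (U : set_system nat) {FU : ProperFilter U}.
Implicit Types (u v : nat -> R[i]) (l k : R[i]).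

(** Limits are taken in the real and imaginary parts because [cintegral] is
    defined through them. *)
Definition ccvg u l : Prop :=
  complex.Re (u n) @[n --> U] --> complex.Re l /\
  complex.Im (u n) @[n --> U] --> complex.Im l.

Lemma ccvg_cst l : ccvg (fun=> l) l.
Proof. by split; exact: cvg_cst. Qed.

Lemma ccvg_real (r : nat -> R) (s : R) : r n @[n --> U] --> s ->
  ccvg (fun n => (r n)%:C) s%:C.
Proof. by move=> rs; split => //; exact: cvg_cst. Qed.

Lemma ccvgD u v l k : ccvg u l -> ccvg v k -> ccvg (fun n => u n + v n) (l + k).
Proof.
move=> [ur ui] [vr vi]; split.
  rewrite raddfD; under eq_fun do rewrite raddfD.
  exact: cvgD.
by rewrite raddfD; under eq_fun do rewrite raddfD; exact: cvgD.
Qed.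

Lemma ccvgN u l : ccvg u l -> ccvg (fun n => - u n) (- l).
Proof.
move=> [ur ui]; split.
  by rewrite raddfN; under eq_fun do rewrite raddfN; exact: cvgN.
by rewrite raddfN; under eq_fun do rewrite raddfN; exact: cvgN.
Qed.

Lemma complex_ReM l k : complex.Re (l * k) =
  complex.Re l * complex.Re k - complex.Im l * complex.Im k.
Proof. by case: l => ? ?; case: k. Qed.

Lemma complex_ImM l k : complex.Im (l * k) =
  complex.Re l * complex.Im k + complex.Im l * complex.Re k.
Proof. by case: l => ? ?; case: k. Qed.

Lemma ccvgM u v l k : ccvg u l -> ccvg v k -> ccvg (fun n => u n * v n) (l * k).
Proof.
move=> [ur ui] [vr vi]; split.
  rewrite complex_ReM; under eq_fun do rewrite complex_ReM.
  by apply: cvgB; exact: cvgM.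
rewrite complex_ImM; under eq_fun do rewrite complex_ImM.
by apply: cvgD; exact: cvgM.
Qed.

Lemma ccvgV u l : l != 0 -> ccvg u l -> ccvg (fun n => (u n)^-1) l^-1.
Proof.
move=> l0 [ur ui].
have ReV k : complex.Re k^-1 = complex.Re k / (complex.Re k ^+ 2 + complex.Im k ^+ 2).
  by case: k.
have ImV k : complex.Im k^-1 = - (complex.Im k / (complex.Re k ^+ 2 + complex.Im k ^+ 2)).
  by case: k.
have n0 : complex.Re l ^+ 2 + complex.Im l ^+ 2 != 0.
  rewrite paddr_eq0 ?sqr_ge0// !sqrf_eq0; apply: contra l0.
  by case: l {ur ui} => x y /= /andP[/eqP-> /eqP->].
have nrm : (complex.Re (u n) ^+ 2 + complex.Im (u n) ^+ 2)^-1 @[n --> U]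
    --> (complex.Re l ^+ 2 + complex.Im l ^+ 2)^-1.
  by apply: cvgV => //; apply: cvgD; exact: cvgM.
split.
  by rewrite ReV; under eq_fun do rewrite ReV; exact: cvgM.
rewrite ImV; under eq_fun do rewrite ImV; apply: cvgN; exact: cvgM.
Qed.

Lemma ccvg_unique u l k : ccvg u l -> ccvg u k -> l = k.
Proof.
case: l => lx ly; case: k => kx ky [/= ur ui] [/= vr vi].
by rewrite (cvg_unique _ ur vr)// (cvg_unique _ ui vi).
Qed.

End ComplexLimits.

(** * Discretization of a measure *)

Section Discretization.
Context {R : realType}.
Variables (a b : R) (sigma : {finite_measure set (measurableTypeR R) -> \bar R}).
Hypothesis ab : a < b.
Let D : set (measurableTypeR R) := `[a, b]%classic.

(** The multiple of y - a + 1 makes all weights of the discretization positive,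
    including those of intervals which [sigma] does not charge, and it vanishes
    in the limit. *)
Definition perturbed_cdf n (y : R) : R :=
  cdf_on sigma D y + n.+1%:R^-1 * (y - a + 1).

Definition grid_weight n j : R :=
  if j is i.+1 then perturbed_cdf n (grid a b n i.+1) - perturbed_cdf n (grid a b n i)
  else perturbed_cdf n a.

Let mD : measurable D. Proof. exact: measurable_itv. Qed.

Let mDy y : measurable (D `&` `]-oo, y]%classic : set (measurableTypeR R)).
Proof. by apply: measurableI => //; exact: measurable_itv. Qed.

Lemma cdf_on_mono : {homo cdf_on sigma D : x y / x <= y}.
Proof.
move=> x y xy; rewrite /cdf_on fine_le ?fin_num_measure//.
rewrite le_measure ?inE//; apply: setIS => t /=; rewrite !in_itv/= => /le_trans.
exact.
Qed.

Lemma perturbed_cdf_incr n : {homo perturbed_cdf n : x y / x < y}.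
Proof.
move=> x y xy; rewrite /perturbed_cdf ler_ltD ?cdf_on_mono ?ltW//.
by rewrite ltr_pM2l ?invr_gt0// ltrD2r ltrD2r.
Qed.

Lemma grid_weight_gt0 n j : 0 < grid_weight n j.
Proof.
case: j => [|j] /=; last by rewrite subr_gt0 perturbed_cdf_incr// grid_incr.
by rewrite /perturbed_cdf subrr add0r mulr1 ltr_wpDl ?invr_gt0// fine_ge0.
Qed.

Lemma grid_weight_cvg (f : R -> R) (K : R) : 0 <= K -> lipschitz_itv a b K f ->
  \sum_(j < n.+2) grid_weight n j * f (grid a b n j) @[n --> \oo]
    --> (\int[sigma]_(t in D) f t : R).
Proof.
move=> K0 fK.
pose B := `|f a| + K * (b - a).
have fB t : t \in `[a, b] -> `|f t| <= B.
  by move=> tI; apply: lipschitz_itv_bounded => //; exact: ltW.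
pose M := fine (sigma D).
have M0 : 0 <= M by rewrite fine_ge0.
have ba : 0 <= b - a by rewrite subr_ge0 ltW.
have B0 : 0 <= B by rewrite /B addr_ge0// mulr_ge0.
pose C := K * (b - a) * M + B * (b - a + 1).
have C0 : 0 <= C by rewrite addr_ge0// !mulr_ge0// addr_ge0.
have sumE n : \sum_(j < n.+2) grid_weight n j * f (grid a b n j) =
    rsum f (grid a b n) n.+1 (cdf_on sigma D)
    + n.+1%:R^-1 * rsum f (grid a b n) n.+1 (fun y => y - a + 1).
  by rewrite -rsumD big_ord_recl /rsum/= grid0.
have err n : `|\int[sigma]_(t in D) f t
    - \sum_(j < n.+2) grid_weight n j * f (grid a b n j)| <= C / n.+1%:R.
  have gm := grid_mono a b n ab.
  have n0 : 0 <= (b - a) / n.+1%:R by rewrite divr_ge0.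
  rewrite sumE opprD addrA (le_trans (ler_normB _ _))// /C mulrDl lerD//.
    have := @rsum_integral_err _ sigma K ((b - a) / n.+1%:R) f (grid a b n) n.+1 gm.
    rewrite grid0 grid_last => /(_ _ n0 K0 fK); rewrite -/D => /(_ _ _).
    have -> : K * ((b - a) / n.+1%:R) * fine (sigma D) = K * (b - a) * M / n.+1%:R.
      by rewrite /M; ring.
    apply; first by move=> j _; rewrite grid_step.
    by apply: (@lipschitz_integrable _ _ a b K) => //; exact: ltW.
  rewrite normrM ger0_norm ?invr_ge0// mulrC ler_wpM2r ?invr_ge0//.
  rewrite -{2}(grid_last a b n); apply: rsum_bound => //.
  - by move=> u v uv; rewrite !lerD2r.
  - by rewrite grid0 subrr add0r.
  - by move=> j jn; apply: fB; exact: grid_seg.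
apply/cvgrPdist_le => e e0.
have [N Ne] := mesh_small R C e e0.
exists N => // n /= Nn; apply: (le_trans (err n)); apply: le_trans Ne.
by rewrite ler_wpM2l// lef_pV2 ?posrE ?ltr0n// ler_nat.
Qed.

End Discretization.

(** * Markov functions *)

Section StieltjesSums.
Context {R : realType} {n : nat} (m s : 'I_n -> R).

Lemma Re_stieltjes_sum (x : R[i]) : complex.Re (stieltjes_sum m s x) =
  \sum_k m k * complex.Re (((s k)%:C - x)^-1).
Proof.
by rewrite raddf_sum; apply: eq_bigr => k _; rewrite [LHS]complex_ReM mul0r subr0.
Qed.

Lemma Im_stieltjes_sum (x : R[i]) : complex.Im (stieltjes_sum m s x) =
  \sum_k m k * complex.Im (((s k)%:C - x)^-1).
Proof.
by rewrite raddf_sum; apply: eq_bigr => k _; rewrite [LHS]complex_ImM mul0r addr0.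
Qed.

Lemma Im_stieltjes_sum_ge (a b c : R) (x : R[i]) :
  (forall k, 0 <= m k) -> (forall k, s k \in `[a, b]) ->
  (forall t, t \in `[a, b] -> c <= complex.Im ((t%:C - x)^-1)) ->
  c * \sum_k m k <= complex.Im (stieltjes_sum m s x).
Proof.
move=> m0 sI cI; rewrite Im_stieltjes_sum mulr_sumr; apply: ler_sum => k _.
by rewrite mulrC ler_wpM2l// cI.
Qed.

End StieltjesSums.

Lemma upper_not_segment (R : realType) (a b : R) (x : R[i]) :
  0 < complex.Im x -> (~` real_segment a b) x.
Proof. by move=> x0 [t _ tx]; move: x0; rewrite -tx ltxx. Qed.

Lemma Im_cintegral_gt0 (R : realType) (a b : R)
    (sigma : {finite_measure set (measurableTypeR R) -> \bar R}) (x : R[i]) :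
  a < b -> sigma `[a, b]%classic <> 0%E -> 0 < complex.Im x ->
  0 < complex.Im (cintegral sigma `[a, b]%classic (fun t => (t%:C - x)^-1)).
Proof.
move=> ab sD x0 /=.
have mD : measurable (`[a, b]%classic : set (measurableTypeR R)) by exact: measurable_itv.
have [c c0 cP] := Im_resolvent_ge a b _ x0.
have [K K0 [_ fK]] := resolvent_lipschitz a b x (ltW ab) (upper_not_segment _ _ _ _ x0).
apply: (@lt_le_trans _ _ (c * fine (sigma `[a, b]%classic))).
  rewrite mulr_gt0// fine_gt0//; apply/andP; split.
    by rewrite lt0e; apply/andP; split; [exact/eqP|].
  by rewrite ltey_eq fin_num_measure.
rewrite -Rintegral_cst//; apply: le_Rintegral => //.
- by apply: (@bounded_integrable _ _ _ _ `|c|) => //; exact: measurable_cst.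
- by apply: (@lipschitz_integrable _ _ a b K) => //; exact: ltW.
Qed.

Lemma cintegral_cvg (R : realType) (a b : R) (U : set_system nat)
    (mu : {finite_measure set (measurableTypeR R) -> \bar R}) (p : nat -> nat)
    (m s : forall n, 'I_(p n) -> R) : a < b ->
  (forall f K, 0 <= K -> lipschitz_itv a b K f ->
    \sum_k m n k * f (s n k) @[n --> U] --> (\int[mu]_(t in `[a, b]) f t : R)) ->
  forall x, (~` real_segment a b) x ->
    ccvg U (fun n => stieltjes_sum (m n) (s n) x)
      (cintegral mu `[a, b]%classic (fun t => (t%:C - x)^-1)).
Proof.
move=> ab cvgf x xI.
have [K K0 [rK iK]] := resolvent_lipschitz a b x (ltW ab) xI.
split.
  by under eq_fun do rewrite Re_stieltjes_sum; exact: cvgf rK.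
by under eq_fun do rewrite Im_stieltjes_sum; exact: cvgf iK.
Qed.

Lemma markov_class0_cintegral (R : realType) (a b : R)
    (mu : {finite_measure set (measurableTypeR R) -> \bar R}) :
  a <= b -> mu (~` `[a, b]%classic) = 0%E ->
  markov_class0 a b (fun x => cintegral mu `[a, b]%classic (fun t => (t%:C - x)^-1)).
Proof.
move=> ab muD; have [mu0|mu0] := eqVneq (mu `[a, b]%classic) 0%E; last first.
  by left; exists mu; split=> //; apply/eqP.
right=> x xI /=.
have [K K0 [rK iK]] := resolvent_lipschitz a b x ab xI.
have null f : lipschitz_itv a b K f -> (\int[mu]_(t in `[a, b]) f t)%R = 0 :> R.
  move=> fK; rewrite /Rintegral null_set_integral//.
  by have /integrableP[] := lipschitz_integrable R mu a b K f ab K0 fK.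
by rewrite /cintegral !null.
Qed.

(** Convergence at one point of the upper half plane controls all the masses. *)
Lemma stieltjes_sum_mass_bounded (R : realType) (a b : R) (p : nat -> nat)
    (m s : forall n, 'I_(p n) -> R) (x l : R[i]) :
  (forall n k, 0 <= m n k) -> (forall n k, s n k \in `[a, b]) ->
  0 < complex.Im x -> ccvg \oo (fun n => stieltjes_sum (m n) (s n) x) l ->
  exists B, forall n, \sum_k m n k <= B.
Proof.
move=> m0 sI x0 [_ cvgl].
have [c c0 cP] := Im_resolvent_ge a b x x0.
have [M [_ bM]] := cvg_seq_bounded (cvgP _ cvgl).
exists ((M + 1) / c) => n; rewrite ler_pdivlMr// mulrC.
apply: (le_trans (Im_stieltjes_sum_ge _ _ a b c x (m0 n) (sI n) cP)).
apply: (le_trans (ler_norm _)); apply: (bM (M + 1)) => //.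
by rewrite ltrDl.
Qed.

Lemma real_line_interpolation (R : realType) (z c : R[i]) : 0 < complex.Im z ->
  (complex.Im c / complex.Im z)%:C * z
    - (complex.Im c / complex.Im z * complex.Re z - complex.Re c)%:C = c.
Proof.
case: z c => u v [r i] /= v0; simpc; congr (_ +i* _); last by rewrite divfK// gt_eqF.
by ring.
Qed.

Lemma mul_sub_conj_neq0 (R : realType) (x z : R[i]) :
  0 < complex.Im z -> complex.Im z < complex.Im x -> (x - z) * (x - conjc z) != 0.
Proof.
case: x z => p q [u v] /= v0 vq.
by rewrite mulf_neq0// subr_eq0; apply/eqP => -[_ /eqP]; lra.
Qed.

Theorem lemma3p1 (R : realType) (alpha beta : R) (hab : alpha < beta)
    (phi : R[i] -> R[i]) (hphi : markov_class alpha beta phi)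
    (z : R[i]) (hz : 0 < complex.Im z) :
  exists (a1 a2 b : R) (tau : R[i] -> R[i]),
    [/\ 0 < b,
        markov_class0 alpha beta tau &
        forall lambda : R[i], (~` real_segment alpha beta) lambda ->
          let den := a2%:C * lambda - a1%:C
            + b%:C ^+ 2 * (lambda - z) * (lambda - conjc z) * tau lambda in
          den <> 0 /\ phi lambda = - (1 / den)].
Proof.
have [sigma [_ sigma_neq0 phiE]] := hphi.
pose t n (j : nat) := grid alpha beta n j.
pose w n j := grid_weight alpha beta sigma n j.
pose phin n := stieltjes_sum (fun j : 'I_n.+2 => w n j) (fun j => t n j).
have t_seg n (j : 'I_n.+2) : t n j \in `[alpha, beta].
  by apply: grid_seg => //; exact: leq_ord.
have phin_cvg x : (~` real_segment alpha beta) x -> ccvg \oo (phin^~ x) (phi x).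
  move=> xI; rewrite phiE//; apply: cintegral_cvg => // f K K0 fK.
  exact: grid_weight_cvg fK.
have phi_neq0 x : 0 < complex.Im x -> phi x != 0.
  move=> x0; rewrite phiE; last exact: upper_not_segment.
  have := Im_cintegral_gt0 _ _ _ sigma x hab sigma_neq0 x0.
  by apply: contraTneq => ->; rewrite ltxx.
have phin_neq0 n x : 0 < complex.Im x -> phin n x != 0.
  move=> x0; have [c c0 cP] := Im_resolvent_ge alpha beta x x0.
  have : 0 < complex.Im (phin n x).
    apply: lt_le_trans (Im_stieltjes_sum_ge _ _ alpha beta c x _ (t_seg n) cP).
      rewrite mulr_gt0// big_ord_recl ltr_wpDr//; last exact: grid_weight_gt0.
      by apply: sumr_ge0 => j _; apply/ltW/grid_weight_gt0.
    by move=> j; apply/ltW/grid_weight_gt0.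
  by apply: contraTneq => ->; rewrite ltxx.
(* The affine function with real coefficients that takes the value c at z. *)
pose slope (c : R[i]) := complex.Im c / complex.Im z.
pose icpt (c : R[i]) := slope c * complex.Re z - complex.Re c.
have lineE c : (slope c)%:C * z - (icpt c)%:C = c.
  exact: real_line_interpolation.
pose a1 n := icpt (- (phin n z)^-1); pose a2 n := slope (- (phin n z)^-1).
have an_z n : 1 + phin n z * ((a2 n)%:C * z - (a1 n)%:C) = 0.
  by rewrite lineE mulrN divff ?subrr// phin_neq0.
have cn_cvg : ccvg \oo (fun n => - (phin n z)^-1) (- (phi z)^-1).
  apply: ccvgN; apply: ccvgV; first exact: phi_neq0.
  by apply: phin_cvg; exact: upper_not_segment.
have a2_cvg : a2 n @[n --> \oo] --> slope (- (phi z)^-1).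
  by apply: cvgMl; exact: cn_cvg.2.
have a1_cvg : a1 n @[n --> \oo] --> icpt (- (phi z)^-1).
  by apply: cvgB; [apply: cvgMl|exact: cn_cvg.1].
have inv n : exists ms : ('I_n.+1 -> R) * ('I_n.+1 -> R),
    (forall k, 0 <= ms.1 k /\ ms.2 k \in `[alpha, beta]) /\
    forall x, (~` real_segment alpha beta) x ->
      1 + phin n x * ((a2 n)%:C * x - (a1 n)%:C
        + (x - z) * (x - conjc z) * stieltjes_sum ms.1 ms.2 x) = 0.
  have [m [s msP]] := discrete_inverse R n.+1 (t n) (w n) z (a1 n) (a2 n)
    (grid_incr alpha beta n hab) (grid_weight_gt0 alpha beta sigma hab n) hz (an_z n).
  by exists (m, s); move: msP; rewrite /t grid0 grid_last.
pose m n := (sval (cid (inv n))).1; pose s n := (sval (cid (inv n))).2.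
have m0 n k : 0 <= m n k by have [/(_ k)[]] := svalP (cid (inv n)).
have s_seg n k : s n k \in `[alpha, beta] by have [/(_ k)[]] := svalP (cid (inv n)).
have taun_eq n := (svalP (cid (inv n))).2; rewrite -/(m _) -/(s _) in taun_eq.
have [B mB] : exists B, forall n, \sum_k m n k <= B.
  (* Evaluate at a point where (x - z) * (x - conjc z) does not vanish. *)
  pose x := complex.Re z +i* (complex.Im z + 1).
  have x0 : 0 < complex.Im x by rewrite /= addr_gt0.
  have xI := upper_not_segment R alpha beta x x0.
  pose d := (x - z) * (x - conjc z).
  have d0 : d != 0.
    by apply: mul_sub_conj_neq0 => //=; rewrite ltrDl.
  have tauE n : stieltjes_sum (m n) (s n) x =
      (- (phin n x)^-1 - ((a2 n)%:C * x - (a1 n)%:C)) * d^-1.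
    have p0 := phin_neq0 n x x0; have := taun_eq n x xI.
    rewrite -/d; set L := _ - _; set T := stieltjes_sum _ _ _ => e.
    apply: (mulIf d0); rewrite mulfVK//; apply: (mulfI p0).
    rewrite mulrBr mulrN divff//; apply/eqP; rewrite -subr_eq0 -e; apply/eqP; ring.
  apply: (stieltjes_sum_mass_bounded R alpha beta _ m s x
    ((- (phi x)^-1 - ((slope (- (phi z)^-1))%:C * x - (icpt (- (phi z)^-1))%:C)) * d^-1)) => //.
  under eq_fun do rewrite tauE.
  apply: ccvgM; last exact: ccvg_cst.
  apply: ccvgD; first by apply/ccvgN/ccvgV; [exact: phi_neq0|exact: phin_cvg].
  apply/ccvgN/ccvgD; first by apply: ccvgM; [exact: ccvg_real|exact: ccvg_cst].
  by apply/ccvgN/ccvg_real.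
have [U [FU ooU [mu [muD mu_cvg]]]] :=
  helly alpha beta B (fun n => n.+1) m s hab m0 s_seg mB.
pose tau x := cintegral mu `[alpha, beta]%classic (fun t => (t%:C - x)^-1).
exists (icpt (- (phi z)^-1)), (slope (- (phi z)^-1)), 1, tau; split=> //.
  by apply: markov_class0_cintegral => //; exact: ltW.
move=> x xI; rewrite expr1n mul1r; set den := _ + _.
have tau_cvg := cintegral_cvg R alpha beta U mu _ m s hab mu_cvg x xI.
have U_cvgr (r : nat -> R) (l : R) : r n @[n --> \oo] --> l -> r n @[n --> U] --> l.
  by move=> rl V Vl; apply: ooU; exact: rl.
have U_cvg (u : nat -> R[i]) (l : R[i]) : ccvg \oo u l -> ccvg U u l.
  by move=> [ur ui]; split; exact: U_cvgr.
(* Written as a product, the relation passes to the limit with no case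
   distinction, and it shows that den is not zero. *)
have eq0 : 1 + phi x * den = 0.
  apply: (@ccvg_unique _ U _ (fun=> 0)); last exact: ccvg_cst.
  rewrite -(funext (fun n => taun_eq n x xI)).
  apply: ccvgD; first exact: ccvg_cst.
  apply: ccvgM; first exact/U_cvg/phin_cvg.
  apply: ccvgD; last by apply: ccvgM => //; exact: ccvg_cst.
  apply: ccvgD; last exact/ccvgN/ccvg_real/U_cvgr.
  by apply: ccvgM; [exact/ccvg_real/U_cvgr|exact: ccvg_cst].
have den0 : den != 0.
  by apply: contra_eq_neq eq0 => ->; rewrite mulr0 addr0 oner_neq0.
split; first exact/eqP.
apply: (mulIf den0); rewrite mulNr div1r mulVf//; apply/eqP.
by rewrite -addr_eq0 addrC eq0.
Qed.
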